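(* Let $k\ge 2$ be an integer. For any $(u,v)\in\Delta_k$, $$\mathbb{E}[X_k(u,v)]=uv\qquad\text{and}\qquad \mathbb{V}[X_k(u,v)]=\frac{uv(1-u)(1-v)}{k-1},$$ where $\mathbb{E}$ and $\mathbb{V}$ denote expected value and variance.
   Context: Fix an integer $k\ge 2$. Let $[k]=\{1,\dots,k\}$, $\delta_k=\{0,\tfrac1k,\dots,\tfrac{k-1}{k},1\}$ and $\Delta_k=\delta_k\times\delta_k$. Let $\mathcal{S}_k$ be the set of all permutations of $[k]$. For $\pi\in\mathcal{S}_k$, let $C_\pi\colon\Delta_k\to[0,1]$ be the discrete copula with mass $\tfrac1k$ in each square $[\tfrac{i-1}{k},\tfrac ik]\times[\tfrac{\pi(i)-1}{k},\tfrac{\pi(i)}{k}]$, $i\in[k]$, and mass $0$ in all other squares of the mesh; that is, $C_\pi(\tfrac ik,\tfrac jk)=\tfrac1k\,|\{m\in[k] : m\le i,\ \pi(m)\le j\}|$ for $i,j\in\{0,1,\dots,k\}$. The random discrete copula induced by a permutation, $X_k$, is the random field over $\Delta_k$ given by $X_k(u,v)=C_\pi(u,v)$, where $\pi$ is chosen uniformly at random from $\mathcal{S}_k$ (equivalently, $C_\pi$ is chosen uniformly at random from $\{C_\pi:\pi\in\mathcal{S}_k\}$). *)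

(* Defs.v *)
From HB Require Import structures.
From mathcomp Require Import all_boot all_order all_algebra all_fingroup.
From mathcomp Require Import all_classical all_reals all_analysis.
Import Order.TTheory GRing.Theory Num.Theory.

Set Implicit Arguments.
Unset Strict Implicit.
Unset Printing Implicit Defensive.

Local Open Scope classical_set_scope.
Local Open Scope ring_scope.

Definition delta (R : realType) (k : nat) : set R :=
  [set u | exists i : 'I_k.+1, u = i%:R / k%:R].
Arguments delta : clear implicits.

Definition Delta (R : realType) (k : nat) : set (R * R) :=
  delta R k `*` delta R k.
Arguments Delta : clear implicits.

(* The element a of [k] = {1, ..., k} is encoded by the ordinal a - 1 : 'I_k,
   so m : 'I_k carries the unit of mass whose square has upper right corner
   (m.+1 / k, (s m).+1 / k).  Only the values at (u, v) in Delta R k matter;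
   discrete_copulaE gives them in terms of the mesh indices. *)
Definition discrete_copula (R : realType) (k : nat) (s : 'S_k) (u v : R) : R :=
  k%:R^-1 * #|[set m : 'I_k | (m.+1%:R / k%:R <= u)
                              && ((s m).+1%:R / k%:R <= v)]%SET|%:R.

Lemma discrete_copulaE (R : realType) (k : nat) (s : 'S_k) (i j : 'I_k.+1) :
  discrete_copula s (i%:R / k%:R) (j%:R / k%:R) =
  k%:R^-1 * #|[set m : 'I_k | (m.+1 <= i)%N && ((s m).+1 <= j)%N]%SET|%:R :> R.
Proof.
case: k s i j => [|k] s i j; first by rewrite /discrete_copula invr0 !mul0r.
have k_gt0 : 0 < k.+1%:R^-1 :> R by rewrite invr_gt0 ltr0n.
rewrite /discrete_copula; congr (_ * _%:R); apply: eq_card => m.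
by rewrite !inE !(ler_pM2r k_gt0) !ler_nat.
Qed.

Definition uniform_permutation d (T : measurableType d) (R : realType)
    (P : probability T R) (k : nat) (pi : T -> 'S_k) : Prop :=
  forall s : 'S_k, measurable (pi @^-1` [set s]) /\
    P (pi @^-1` [set s]) = ((k`!)%:R^-1)%:E.

Definition random_discrete_copula (T : Type) (R : realType) (k : nat)
    (pi : T -> 'S_k) (u v : R) : T -> R :=
  fun t => discrete_copula (pi t) u v.

(* Main.v *)
(* Centering the indicators, X - uv is 1/k times the permutation statistic
   sum_m x_m y_(pi m), where x and y both sum to zero.  Since y sums to zero,
   E[y_(pi m) y_(pi n)] for n <> m is -1/(k-1) times E[y_(pi m)^2], and expanding
   the square leaves (sum x_m^2) (sum y_a^2) / (k-1); these two sums are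
   k u (1 - u) and k v (1 - v). *)
Require Import Defs.
From mathcomp Require Import all_boot all_order all_algebra all_fingroup.
From mathcomp Require Import all_classical all_reals all_analysis.
From mathcomp Require Import measurable_realfun ring.
Import Order.TTheory GRing.Theory Num.Theory.

Local Open Scope classical_set_scope.
Local Open Scope ring_scope.

Lemma sum_comp_perm (V : nmodType) (I : finType) (s : {perm I}) (f : I -> V) :
  \sum_a f (s a) = \sum_a f a.
Proof. by rewrite [RHS](reindex_inj (@perm_inj _ s)). Qed.

(** Multiplication by [tperm m n] is a bijection of the group that exchanges evaluation at [m] with
    evaluation at [n]. *)
Lemma sum_perm_eval (R : comNzRingType) (I : finType) (f : I -> R) (m n : I) :
  \sum_(s : {perm I}) f (s m) = \sum_(s : {perm I}) f (s n).
Proof.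
rewrite (reindex_inj (mulgI (tperm m n))) /=.
by apply: eq_bigr => s _; rewrite permM tpermL.
Qed.

(** Sum over all evaluation points: the points contribute equally, and each single [s] merely
    rearranges the values of [f]. Nothing is divided, so any commutative ring will do. *)
Lemma average_perm_eval (R : comNzRingType) (I : finType) (f : I -> R) (m : I) :
  #|I|%:R * \sum_(s : {perm I}) f (s m) = #|{perm I}|%:R * \sum_a f a.
Proof.
transitivity (\sum_n \sum_(s : {perm I}) f (s n)).
  rewrite [RHS](eq_bigr (fun=> \sum_(s : {perm I}) f (s m))) => [|n _].
    by rewrite sumr_const mulr_natl.
  exact: sum_perm_eval.
rewrite exchange_big /= (eq_bigr _ (fun s _ => sum_comp_perm _ _ s f)).
by rewrite sumr_const mulr_natl.
Qed.

Lemma sum_perm_stat (R : comNzRingType) (I : finType) (x y : I -> R) :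
  #|I|%:R * \sum_(s : {perm I}) \sum_m x m * y (s m) =
  #|{perm I}|%:R * (\sum_m x m) * (\sum_a y a).
Proof.
rewrite exchange_big /= mulr_sumr mulrAC [RHS]mulr_sumr.
apply: eq_bigr => m _.
by rewrite -mulr_sumr mulrCA average_perm_eval mulrC.
Qed.

(** Correlation of two values of a random permutation. For fixed [m], the sums over all [n] add up
    to zero, and those with [n != m] are equal, so each is the diagonal one divided by [1 - #|I|].
    The Kronecker term covers [m = n] in the same formula. *)
Lemma sum_perm_eval2 (R : comNzRingType) (I : finType) (y : I -> R) (m n : I) :
  \sum_a y a = 0 ->
  (#|I|%:R - 1) * \sum_(s : {perm I}) y (s m) * y (s n) =
  (m == n)%:R * (#|{perm I}|%:R * \sum_a y a ^+ 2)
  - \sum_(s : {perm I}) y (s m) ^+ 2.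
Proof.
move=> y0; have [<-|neq_mn] := eqVneq m n.
  rewrite mul1r -(average_perm_eval _ _ (fun a => y a ^+ 2) m) mulrBl mul1r.
  by under [X in _ * X - X]eq_bigr do rewrite -expr2.
(* Transposing n with n' fixes m, so the sums over n' != m coincide. *)
have swap n' : n' != m ->
  \sum_(s : {perm I}) y (s m) * y (s n') = \sum_(s : {perm I}) y (s m) * y (s n).
  move=> neq_n'm; rewrite (reindex_inj (mulgI (tperm n n'))) /=.
  by apply: eq_bigr => s _; rewrite !permM tpermR tpermD // eq_sym.
have : \sum_n' \sum_(s : {perm I}) y (s m) * y (s n') = 0.
  rewrite exchange_big /= big1 // => s _.
  by rewrite -mulr_sumr sum_comp_perm y0 mulr0.
rewrite (bigD1 m) //= (eq_bigr _ swap) sumr_const cardC1.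
under [X in X + _]eq_bigr do rewrite -expr2.
move/eqP; rewrite addrC addr_eq0 => /eqP <-.
have I_gt0 : (0 < #|I|)%N by apply/card_gt0P; exists m.
by rewrite mul0r add0r -[in LHS](prednK I_gt0) -natr1 addrK mulr_natl.
Qed.

Lemma sum_sqr_perm_stat (R : comNzRingType) (I : finType) (x y : I -> R) :
  \sum_m x m = 0 -> \sum_a y a = 0 ->
  (#|I|%:R - 1) * \sum_(s : {perm I}) (\sum_m x m * y (s m)) ^+ 2 =
  #|{perm I}|%:R * (\sum_m x m ^+ 2) * (\sum_a y a ^+ 2).
Proof.
move=> x0 y0.
transitivity (\sum_m x m * \sum_n x n *
    ((#|I|%:R - 1) * \sum_(s : {perm I}) y (s m) * y (s n))).
  rewrite [LHS]mulr_sumr.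
  under [LHS]eq_bigr do rewrite expr2 big_distrlr /= mulr_sumr.
  rewrite exchange_big /=; apply: eq_bigr => m _.
  under eq_bigr do rewrite mulr_sumr.
  rewrite exchange_big /= mulr_sumr; apply: eq_bigr => n _.
  by rewrite !mulr_sumr; apply: eq_bigr => s _; ring.
rewrite mulrAC [RHS]mulr_sumr; apply: eq_bigr => m _.
under eq_bigr do rewrite sum_perm_eval2 // mulrBr.
(* The subtracted term does not depend on [n], so [x0] kills it; the Kronecker term leaves only
   [n = m]. *)
rewrite sumrB -mulr_suml x0 mul0r subr0 (bigD1 m) //= eqxx.
rewrite [X in _ + X]big1 ?addr0; first by rewrite mul1r; ring.
by move=> n; rewrite eq_sym => /negbTE ->; rewrite mul0r mulr0.
Qed.

Lemma sum_ord_lt (R : comNzRingType) (k i : nat) : (i <= k)%N ->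
  \sum_(m < k) (m < i)%N%:R = i%:R :> R.
Proof.
move=> le_ik; rewrite -[in RHS](card_ord i) -sum1_card.
rewrite (big_ord_widen k (fun=> 1%N)) // natr_sum [RHS]big_mkcond /=.
by apply: eq_bigr => m _; case: ifP.
Qed.

Lemma sum_centered_ord_lt (R : fieldType) (k i : nat) : (i <= k)%N ->
  k%:R != 0 :> R -> \sum_(m < k) ((m < i)%N%:R - i%:R / k%:R) = 0 :> R.
Proof.
move=> le_ik k_neq0; rewrite sumrB sum_ord_lt // sumr_const card_ord.
by rewrite -[X in _ - X]mulr_natr divfK ?subrr.
Qed.

Lemma sum_sqr_centered_ord_lt (R : fieldType) (k i : nat) : (i <= k)%N ->
  k%:R != 0 :> R ->
  \sum_(m < k) ((m < i)%N%:R - i%:R / k%:R) ^+ 2 =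
  k%:R * (i%:R / k%:R) * (1 - i%:R / k%:R) :> R.
Proof.
move=> le_ik k_neq0; set u := i%:R / k%:R.
transitivity (\sum_(m < k) ((m < i)%N%:R * (1 - 2 * u) + u ^+ 2)).
  (* An indicator is its own square, so the summand is affine in it. *)
  by apply: eq_bigr => m _; case: (m < i)%N => /=; ring.
rewrite big_split -mulr_suml /= sum_ord_lt // sumr_const card_ord.
by rewrite -[_ ^+ 2 *+ _]mulr_natr /u; field.
Qed.

Lemma discrete_copula_sum (R : realType) (k : nat) (s : 'S_k) (i j : 'I_k.+1) :
  discrete_copula s (i%:R / k%:R) (j%:R / k%:R) =
  k%:R^-1 * \sum_(m < k) (m < i)%N%:R * (s m < j)%N%:R :> R.
Proof.
rewrite discrete_copulaE; congr (_ * _).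
rewrite -sum1_card natr_sum [LHS]big_mkcond /=; apply: eq_bigr => m _.
by rewrite inE -natrM mulnb; case: ifP.
Qed.

(** [g \o pi] is a finite combination of indicators of the fibres of [pi], whose measurability and
    probability are given. Nonnegativity of [g] lets sum and integral be exchanged without an
    integrability condition. *)
Lemma expectation_uniform_permutation d (T : measurableType d) (R : realType)
    (P : probability T R) (k : nat) (pi : T -> 'S_k) (g : 'S_k -> R) :
  uniform_permutation P pi -> (forall s, 0 <= g s) ->
  'E_P[g \o pi]%E = ((\sum_s g s) / k`!%:R)%:E.
Proof.
move=> unif_pi g_ge0.
transitivity (\int[P]_t
    (\sum_(s : 'S_k) (g s)%:E * (\1_(pi @^-1` [set s]) t)%:E))%E.
  rewrite unlock; apply: eq_integral => t _ /=.
  rewrite (bigD1 (pi t)) //= big1 ?adde0 => [|s neq_s].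
    by rewrite indicE mem_set // mule1.
  rewrite indicE memNset ?mule0 // => /= eq_s.
  by rewrite eq_s eqxx in neq_s.
rewrite ge0_integral_sum //.
- rewrite mulr_suml -sumEFin; apply: eq_bigr => s _.
  have [mpi Ppi] := unif_pi s.
  rewrite ge0_integralZl ?lee_fin //.
    by rewrite integral_indic // setIT EFinM; congr (_ * _)%E; exact: Ppi.
  by apply/measurable_EFinP; exact: measurable_indic.
- move=> s; apply: measurable_funeM.
  by apply/measurable_EFinP/measurable_indic; have [] := unif_pi s.
- by move=> s t _; rewrite mule_ge0 ?lee_fin.
Qed.

Theorem theorem3p4 (R : realType) (k : nat) (hk : (2 <= k)%N)
    (d : measure_display) (T : measurableType d) (P : probability T R)
    (pi : T -> 'S_k) (hpi : uniform_permutation P pi)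
    (u v : R) (huv : (u, v) \in Delta R k) :
  ('E_P[random_discrete_copula pi u v] = (u * v)%:E)%E /\
  ('V_P[random_discrete_copula pi u v] =
     (u * v * (1 - u) * (1 - v) / (k%:R - 1))%:E)%E.
Proof.
have [[i def_u] [j def_v]] : delta R k u /\ delta R k v.
  by move: huv; rewrite inE.
have k_neq0 : k%:R != 0 :> R by rewrite pnatr_eq0 -lt0n (ltnW hk).
have k1_neq0 : k%:R - 1 != 0 :> R.
  by rewrite subr_eq0 (eqr_nat _ k 1) neq_ltn hk orbT.
have fact_neq0 : k`!%:R != 0 :> R by rewrite pnatr_eq0 -lt0n fact_gt0.
have [le_ik le_jk] : (i <= k)%N /\ (j <= k)%N by rewrite -ltnS -(ltnS j).
have Epi g := expectation_uniform_permutation _ _ _ _ _ _ g hpi.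
have meanX : ('E_P[random_discrete_copula pi u v] = (u * v)%:E)%E.
  rewrite (Epi (fun s => discrete_copula s u v)).
    congr (_%:E); rewrite def_u def_v.
    under eq_bigr do rewrite discrete_copula_sum.
    have := sum_perm_stat _ _ (fun m : 'I_k => (m < i)%N%:R : R)
                               (fun a : 'I_k => (a < j)%N%:R).
    rewrite card_ord card_Sn !sum_ord_lt // => eqS.
    apply: (mulfI k_neq0); rewrite -mulr_sumr mulrA mulrCA eqS.
    by field; rewrite k_neq0.
  by move=> s; rewrite /discrete_copula mulr_ge0 ?invr_ge0 ?ler0n.
split=> //; rewrite /variance unlock meanX /=.
(* The variance is now the expectation of a squared deviation, a nonnegative function of the
   permutation. *)
rewrite (Epi (fun s => (discrete_copula s u v - u * v) ^+ 2)); last first.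
  by move=> s; exact: sqr_ge0.
congr (_%:E).
pose x (m : 'I_k) : R := (m < i)%N%:R - u.
pose y (a : 'I_k) : R := (a < j)%N%:R - v.
have copulaB s : discrete_copula s u v - u * v = k%:R^-1 * \sum_m x m * y (s m).
  (* Expanding the product of [x] and [y]: the middle term gives [u * v] after division by [k], and
     the last one vanishes because [y] sums to zero. *)
  transitivity (k%:R^-1 * (\sum_(m < k) (m < i)%N%:R * (s m < j)%N%:R
      - (\sum_(m < k) (m < i)%N%:R) * v - u * \sum_m y (s m))).
    rewrite sum_comp_perm /y def_u def_v sum_centered_ord_lt // sum_ord_lt //.
    by rewrite discrete_copula_sum; field.
  congr (_ * _); rewrite mulr_suml mulr_sumr -!sumrB.
  by apply: eq_bigr => m _; rewrite /x /y; ring.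
under eq_bigr do rewrite copulaB exprMn.
have := sum_sqr_perm_stat _ _ x y.
rewrite /x /y def_u def_v !sum_centered_ord_lt // !sum_sqr_centered_ord_lt //.
rewrite card_ord card_Sn => /(_ erefl erefl) eqS.
(* In [eqS] the factors [k] of the two sums of squares cancel the squared [k%:R^-1]. *)
apply: (mulfI k1_neq0).
by rewrite -mulr_sumr mulrA mulrCA eqS; field; rewrite ?k_neq0 ?k1_neq0.
Qed.
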